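(* Let $G$ be the graph with $V(G)=\mathbb{Z}^n$ and $E(G)=\{\{x,y\}: x,y\in\mathbb{Z}^n,\ \sum_{i=1}^n|x_i-y_i|=1\}$. Let $\Omega$ be a nonempty finite subset of $\mathbb{Z}^n$. Consider the graph $\tilde\Omega$ as an edge-weighted graph with each edge of weight $1$, and let $T^{(0)}$ be the Dirichlet-to-Neumann map for functions of $(\tilde\Omega,\delta\Omega)$. Then $$\lambda_1(T^{(0)})+\lambda_2(T^{(0)})+\cdots+\lambda_n(T^{(0)})\leq \sum_{v\in\delta\Omega}\frac{1}{\deg v}\sum_{i=1}^n\frac{\deg_iv}{|E_i(\tilde\Omega)|},$$ where $\deg v$ is the number of edges of $\tilde\Omega$ incident to $v$, $\deg_i v$ is the number of edges of $\tilde\Omega$ incident to $v$ that are parallel to $e_i$, and $E_i(\tilde\Omega)$ is the set of edges of $\tilde\Omega$ that are parallel to $e_i$; here $\{e_1,\dots,e_n\}$ is the standard basis of $\mathbb{R}^n$. As a consequence, $$\lambda_1(T^{(0)})+\lambda_2(T^{(0)})+\cdots+\lambda_n(T^{(0)})\leq \frac{|\delta\Omega|}{\min_{1\leq i\leq n}|E_i(\tilde\Omega)|}.$$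
   Context: For $\Omega\subset V(G)$, $\delta\Omega$ is the set of vertices not in $\Omega$ that are adjacent to some vertex of $\Omega$, $\overline\Omega=\Omega\cup\delta\Omega$, and $\tilde\Omega$ is the subgraph of $G$ with vertex set $\overline\Omega$ and edge set $E(\Omega,\overline\Omega)$, the edges of $G$ with one end in $\Omega$ and the other in $\overline\Omega$ (so there are no edges between vertices of $\delta\Omega$). With each edge of weight $1$, the induced (normalized) weight of a vertex $v$ of $\tilde\Omega$ is $\deg v$, its degree in $\tilde\Omega$. The map $T^{(0)}$ acts on functions $\varphi:\delta\Omega\to\mathbb{R}$: let $\omega:\overline\Omega\to\mathbb{R}$ be a solution of $\frac{1}{\deg x}\sum_{y\sim x}(\omega(x)-\omega(y))=0$ for all $x\in\Omega$ (neighbours in $\tilde\Omega$), $\omega|_{\delta\Omega}=\varphi$; then $T^{(0)}\varphi(v)=\frac{1}{\deg v}\sum_{u\in\Omega,\,u\sim v}(\varphi(v)-\omega(u))$ for $v\in\delta\Omega$ (this is well defined). It is a nonnegative self-adjoint operator on the space of functions on $\delta\Omega$ with inner product $\langle\varphi,\psi\rangle=\sum_{v\in\delta\Omega}\varphi(v)\psi(v)\deg v$. For a nonnegative self-adjoint operator $T$ on a finite-dimensional inner product space, $\lambda_i(T)$ is its $i$-th positive eigenvalue, in ascending order and counted with multiplicity; the statement is understood to include that $\lambda_1,\dots,\lambda_n$ exist. *)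

(* Defs.v *)
From HB Require Import structures.
From mathcomp Require Import all_boot all_order all_algebra finmap.
From mathcomp Require Import boolp classical_sets reals.

Set Implicit Arguments.
Unset Strict Implicit.
Unset Printing Implicit Defensive.

Import Order.TTheory GRing.Theory Num.Theory.
Local Open Scope fset_scope.
Local Open Scope ring_scope.

Section Lattice.
Variable n : nat.
Implicit Types (x y v : 'rV[int]_n) (Omega : {fset 'rV[int]_n}).

Definition Zadj x y : bool := \sum_i `|x 0 i - y 0 i| == 1.

Definition basis_vec (i : 'I_n) : 'rV[int]_n := delta_mx 0 i.

(* The ambient finite set of points x + e_i, x - e_i (x in Omega) only serves to
   make the comprehension finite; see in_bdry. *)
Definition bdry Omega : {fset 'rV[int]_n} :=
  [fset y in [fset x + basis_vec i | x in Omega, i in 'I_n] `|`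
             [fset x - basis_vec i | x in Omega, i in 'I_n]
   | (y \notin Omega) && [exists x : Omega, Zadj (val x) y]].

Definition clos Omega : {fset 'rV[int]_n} := Omega `|` bdry Omega.

Definition edges Omega : {fset {fset 'rV[int]_n}} :=
  [fset [fset x; y] | x in Omega, y in clos Omega & Zadj x y].

Definition tadj Omega x y : bool := [fset x; y] \in edges Omega.

(* z = z_i e_i, i.e. z is a scalar multiple of e_i, for every difference z of
   two endpoints. *)
Definition parallel (i : 'I_n) (e : {fset 'rV[int]_n}) : bool :=
  [forall x : e, forall y : e,
     val x - val y == (val x - val y) 0 i *: basis_vec i].

Definition edges_par Omega (i : 'I_n) : {fset {fset 'rV[int]_n}} :=
  [fset e in edges Omega | parallel i e].

Definition deg Omega v : nat := #|` [fset e in edges Omega | v \in e]|.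

Definition deg_par Omega (i : 'I_n) v : nat :=
  #|` [fset e in edges_par Omega i | v \in e]|.

Lemma Zadj_sym x y : Zadj x y = Zadj y x.
Proof.
by rewrite /Zadj; congr (_ == _); apply: eq_bigr => i _; rewrite distrC.
Qed.

Lemma Zadj_basis x y : Zadj x y ->
  exists i, y = x + basis_vec i \/ y = x - basis_vec i.
Proof.
move=> /eqP h.
have [i hi] : exists i, x 0 i != y 0 i.
  apply/existsP; apply: contraPT h; rewrite negb_exists => /forallP h.
  rewrite big1 // => i _; move: (h i); rewrite negbK => /eqP ->.
  by rewrite subrr normr0.
move: h; rewrite (bigD1 i) //= => h.
have h1 : 1 <= `|x 0 i - y 0 i|.
  by rewrite -gtz0_ge1 normr_gt0 subr_eq0.
have h2 : 0 <= \sum_(j < n | j != i) `|x 0 j - y 0 j| by apply: sumr_ge0.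
have e1 : `|x 0 i - y 0 i| = 1.
  by apply/eqP; rewrite eq_le h1 andbT -h lerDl.
move: h; rewrite e1 => /eqP; rewrite -subr_eq0 addrAC subrr add0r.
rewrite psumr_eq0 // => /allP h.
have h0 j : j != i -> x 0 j = y 0 j.
  move=> ji; move: (h j); rewrite mem_index_enum ji normr_eq0 subr_eq0.
  by move=> /(_ isT) /eqP.
exists i; have : (y 0 i - x 0 i == 1) || (y 0 i - x 0 i == - 1).
  by have := eqr_norml (y 0 i - x 0 i) 1; rewrite distrC e1 eqxx ler01 andbT.
case/orP=> /eqP e; [left|right]; apply/rowP => j; rewrite !mxE eqxx /=;
  have [->|ji] := eqVneq j i; rewrite ?mulr1n ?mulr0n.
- by rewrite -e addrC subrK.
- by rewrite addr0 h0.
- by rewrite -e addrC subrK.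
- by rewrite subr0 h0.
Qed.

Lemma in_bdry Omega y :
  (y \in bdry Omega) = (y \notin Omega) && [exists x : Omega, Zadj (val x) y].
Proof.
rewrite !inE /=; apply: andb_idl => /andP[_ /existsP[x /Zadj_basis[i xy]]].
apply/orP; case: xy => ->; [left|right]; apply/imfset2P.
  by exists (val x); [exact: valP|exists i].
by exists (val x); [exact: valP|exists i].
Qed.

Lemma Zadj_add_basis x i : Zadj x (x + basis_vec i).
Proof.
apply/eqP; rewrite (bigD1 i) //= big1 => [|j ji].
  by rewrite addr0 !mxE !eqxx /= opprD addrA subrr add0r normrN normr1.
by rewrite !mxE eqxx (negPf ji) /= addr0 subrr normr0.
Qed.

Lemma clos_nbr Omega x y : x \in Omega -> Zadj x y -> y \in clos Omega.
Proof.
move=> xO xy; rewrite in_fsetU; case: (boolP (y \in Omega)) => //= yO.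
by rewrite in_bdry yO; apply/existsP; exists [` xO].
Qed.

Lemma tadjE Omega x y : x \in Omega -> tadj Omega x y = Zadj x y.
Proof.
move=> xO; apply/idP/idP; last first.
  move=> xy; apply/imfset2P; exists x => //; exists y => //.
  by rewrite inE /= (clos_nbr xO xy).
have Zneq a b : Zadj a b -> a != b.
  apply: contraTneq => ->; rewrite /Zadj big1 // => i _.
  by rewrite subrr normr0.
move=> /imfset2P[a aO [b /= ]]; rewrite inE /= => /andP[_ ab].
move=> /fsetP h; have := h a; have := h b; have := Zneq _ _ ab.
rewrite !inE !eqxx /= !orbT => ne hb ha; move: ne.
case/orP: ha => /eqP ea; case/orP: hb => /eqP eb; subst a b; rewrite ?eqxx //.
by rewrite Zadj_sym.
Qed.

End Lattice.

Section DirichletToNeumann.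
Variables (R : realType) (n : nat) (Omega : {fset 'rV[int]_n}).

Definition clos_in (u : Omega) : clos Omega := fincl (fsubsetUl _ _) u.
Definition clos_bdry (v : bdry Omega) : clos Omega := fincl (fsubsetUr _ _) v.

Definition harmonic_extension
    (phi : {ffun bdry Omega -> R^o}) (w : {ffun clos Omega -> R^o}) : Prop :=
  (forall x : Omega, (deg Omega (val x))%:R^-1 *
     (\sum_(y : clos Omega | tadj Omega (val x) (val y))
         (w (clos_in x) - w y)) = 0)
  /\ (forall v : bdry Omega, w (clos_bdry v) = phi v).

(* Some solution of the Dirichlet problem is selected; for 0 < n it exists and
   is unique (harmonic_extension_ex, harmonic_extension_uniq). *)
Definition some_extension (phi : {ffun bdry Omega -> R^o}) :
    {ffun clos Omega -> R^o} :=
  xget 0 [set w | harmonic_extension phi w]%classic.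

Definition normal_derivative
    (phi : {ffun bdry Omega -> R^o}) (w : {ffun clos Omega -> R^o}) :
    {ffun bdry Omega -> R^o} :=
  [ffun v => (deg Omega (val v))%:R^-1 *
     \sum_(u : Omega | tadj Omega (val u) (val v)) (phi v - w (clos_in u))].

Definition DtN (phi : {ffun bdry Omega -> R^o}) : {ffun bdry Omega -> R^o} :=
  normal_derivative phi (some_extension phi).

Definition dirichlet_op (w : {ffun clos Omega -> R^o}) :
    {ffun clos Omega -> R^o} :=
  [ffun z => if val z \in Omega then
     (deg Omega (val z))%:R^-1 *
       (\sum_(y : clos Omega | tadj Omega (val z) (val y)) (w z - w y))
   else w z].

Lemma dirichlet_op_linear : linear dirichlet_op.
Proof.
move=> a u w; apply/ffunP => z; rewrite !ffunE.
case: ifP => _ //.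
rewrite [X in _ = X + _]mulrCA -mulrDr; congr (_ * _).
rewrite mulr_sumr -big_split /=; apply: eq_bigr => y _.
by rewrite !ffunE /= mulrBr opprD addrACA.
Qed.

HB.instance Definition _ :=
  GRing.isLinear.Build R {ffun clos Omega -> R^o} {ffun clos Omega -> R^o} _
    dirichlet_op dirichlet_op_linear.

Definition extend0 (phi : {ffun bdry Omega -> R^o}) : {ffun clos Omega -> R^o} :=
  [ffun z => if insub (val z) is Some v then phi v else 0].

Lemma harmonic_extensionE phi w :
  harmonic_extension phi w <-> dirichlet_op w = extend0 phi.
Proof.
split=> [[h1 h2]|h].
  apply/ffunP => z; rewrite !ffunE; case: ifP => zO.
    rewrite insubN; last by rewrite in_bdry zO.
    rewrite -[RHS](h1 [` zO]) /=.
    by have -> : clos_in [` zO] = z by apply: val_inj.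
  have zb : val z \in bdry Omega.
    by have := valP z; rewrite in_fsetU zO.
  by rewrite insubT -h2; congr (w _); apply: val_inj.
split=> [x|v].
  have /ffunP/(_ (clos_in x)) := h; rewrite !ffunE /= (valP x) => ->.
  by rewrite insubN // in_bdry (valP x).
have /ffunP/(_ (clos_bdry v)) := h; rewrite !ffunE /=.
have vb : val v \in bdry Omega := valP v.
have := vb; rewrite in_bdry => /andP[/negPf -> _] ->.
by rewrite insubT; congr (phi _); apply: val_inj.
Qed.

Hypothesis n_gt0 : (0 < n)%N.

Lemma dirichlet_op_le0 w : dirichlet_op w = 0 -> forall z, w z <= 0.
Proof.
move=> h z0; pose i0 := Ordinal n_gt0.
pose M := [arg max_(z > z0) w z]%O.
have hM z : w z <= w M by rewrite /M; case: Order.TotalTheory.arg_maxP => //= m _; apply.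
pose N := [arg max_(z > M | w z == w M) (val z) 0 i0]%O.
have [hN hN'] : w N = w M /\ forall z, w z = w M -> val z 0 i0 <= val N 0 i0.
  rewrite /N; case: Order.TotalTheory.arg_maxP => //= m /eqP -> hm; split=> // z /eqP; exact: hm.
apply: le_trans (hM z0) _; rewrite -hN.
have /ffunP/(_ N) := h; rewrite !ffunE; case: ifP => [NO /eqP|_ ->//].
rewrite mulf_eq0 invr_eq0.
have NN := Zadj_add_basis (val N) i0.
pose N' : clos Omega := [` clos_nbr NO NN].
have tN : tadj Omega (val N) (val N') by rewrite tadjE.
have dN : (deg Omega (val N))%:R != 0 :> R.
  rewrite pnatr_eq0 -lt0n /deg cardfs_gt0; apply/fset0Pn.
  exists [fset val N; val N']; rewrite !inE /= eqxx andbT; exact: tN.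
rewrite (negPf dN) /= psumr_eq0 => [|y _]; last by rewrite subr_ge0 hN.
move=> /allP/(_ N'); rewrite mem_index_enum => /(_ isT) /implyP/(_ tN).
rewrite subr_eq0 => /eqP e; have := hN' N'; rewrite -e => /(_ hN).
by rewrite /= !mxE !eqxx /= gerDl ler10.
Qed.

Lemma dirichlet_op_inj : lker (linfun dirichlet_op) == 0%VS.
Proof.
apply/eqP/vspaceP => w; rewrite memv_ker memv0 lfunE /=.
apply/eqP/eqP => [h|->]; last by rewrite linear0.
apply/ffunP => z; rewrite [RHS]ffunE; apply/eqP.
rewrite eq_le dirichlet_op_le0 //=.
have : (- w) z <= 0 by apply: dirichlet_op_le0; rewrite linearN /= h oppr0.
by rewrite ffunE oppr_le0.
Qed.

Lemma harmonic_extension_ex phi : exists w, harmonic_extension phi w.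
Proof.
exists ((linfun dirichlet_op)^-1%VF (extend0 phi)); apply/harmonic_extensionE.
by have := lker0_lfunVK dirichlet_op_inj (extend0 phi); rewrite lfunE.
Qed.

Lemma harmonic_extension_uniq phi w1 w2 :
  harmonic_extension phi w1 -> harmonic_extension phi w2 -> w1 = w2.
Proof.
move=> /harmonic_extensionE h1 /harmonic_extensionE h2.
apply: (can_inj (lker0_lfunK dirichlet_op_inj)).
by rewrite !lfunE /= h1 h2.
Qed.

Lemma DtNE phi w :
  harmonic_extension phi w -> DtN phi = normal_derivative phi w.
Proof.
move=> h; congr normal_derivative; apply: harmonic_extension_uniq (h).
exact: xgetPex (harmonic_extension_ex phi).
Qed.

Lemma DtN_linear : linear DtN.
Proof.
move=> a p q; have [u hu] := harmonic_extension_ex p.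
have [w hw] := harmonic_extension_ex q.
have huw : harmonic_extension (a *: p + q) (a *: u + w).
  move: hu hw => /harmonic_extensionE hu /harmonic_extensionE hw.
  apply/harmonic_extensionE; rewrite linearP /= hu hw.
  apply/ffunP => z; rewrite !ffunE; case: insubP => [v _ _|_].
    by rewrite !ffunE.
  by rewrite scaler0 addr0.
rewrite (DtNE huw) (DtNE hu) (DtNE hw); apply/ffunP => v; rewrite !ffunE.
rewrite [X in _ = X + _]mulrCA -mulrDr; congr (_ * _).
rewrite mulr_sumr -big_split /=; apply: eq_bigr => y _.
by rewrite !ffunE /= mulrBr opprD addrACA.
Qed.

End DirichletToNeumann.

Arguments DtN R {n} Omega.

(* For self-adjoint f the multiplicity of an eigenvalue is the dimension of its
   eigenspace. *)
Definition positive_eigenvalues (R : realType) (vT : vectType R)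
    (f : 'End(vT)) (s : seq R) : Prop :=
  sorted <=%R s /\
  forall a : R, count_mem a s = if 0 < a then \dim (passmx.leigenspace f a) else 0%N.

Lemma positive_eigenvalues_uniq (R : realType) (vT : vectType R)
    (f : 'End(vT)) (s t : seq R) :
  positive_eigenvalues f s -> positive_eigenvalues f t -> s = t.
Proof.
move=> [ss hs] [st ht]; apply: (sorted_eq le_trans le_anti) => //.
by apply/allP => a _; rewrite /= hs ht.
Qed.

(* Main.v *)
From HB Require Import structures.
Require Import Defs.
From mathcomp Require Import all_boot all_order all_algebra finmap.
From mathcomp Require Import boolp classical_sets reals complex ring lra.
Import Order.TTheory GRing.Theory Num.Theory.
Local Open Scope fset_scope.
Local Open Scope ring_scope.

(* The coordinate functions x_i are harmonic on Omega, so the energy form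
   <T x_i, x_j> sums the products of their increments over the edges of the
   domain: it is |E_i| if i = j and 0 otherwise.  Hence the vectors
   T^(1/2) x_i / sqrt |E_i| are orthonormal in the range of T, and Ky Fan's
   principle bounds lambda_1 + ... + lambda_n by the sum of the
   <T x_i, T x_i> / |E_i|.  Finally deg v * T x_i (v) is a sum of deg_i v signs
   which cancel when deg_i v = 2, so its square is at most deg_i v. *)

(** * The spectral theorem for real symmetric operators *)

(** Over [R[i]] the matrix becomes Hermitian, hence unitarily diagonalizable with real spectrum, and
    a real root of the complex characteristic polynomial is already a root of the real one. *)
Lemma symmetric_eigenvalue (R : rcfType) m (S : 'M[R]_m.+1) :
  S^T = S -> exists a, eigenvalue S a.
Proof.
move=> Ssym; pose C := map_mx (real_complex R) S.
have CrealC (x : R) : real_complex R x \is Num.real.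
  by rewrite complex_real.
have Cherm : C \is hermsymmx.
  apply: realsym_hermsym.
    by apply/is_hermitianmxP; rewrite expr0 scale1r map_mx_id // /C map_trmx Ssym.
  by apply/mxOverP => i j; rewrite mxE.
have /orthomx_spectralP CE := hermitian_normalmx Cherm.
have /mxOverP/(_ 0 ord0) dreal := hermitian_spectral_diag_real Cherm.
set P := spectralmx C in CE; set d := spectral_diag C in CE dreal.
have : eigenvalue C (d 0 ord0).
  apply/eigenvalueP; exists (row ord0 P).
    rewrite -row_mul {1}CE !mulmxA mulmxV ?spectral_unit // mul1mx.
    by apply/rowP => j; rewrite mul_diag_mx !mxE.
  (* A zero first row of the invertible [P] would make the corner entry of the product of [P] with
     its inverse vanish. *)
  apply: contraNneq (oner_neq0 R[i]) => P0.
  have /matrixP/(_ ord0 ord0) := mulmxV (spectral_unit C).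
  rewrite [LHS]mxE [RHS]mxE eqxx mulr1n => <-; apply/eqP; rewrite big1 // => j _.
  by move/rowP: P0 => /(_ j); rewrite !mxE => ->; rewrite mul0r.
have [a ->] : exists a, d 0 ord0 = real_complex R a.
  by exists (complex.Re (d 0 ord0)); rewrite RRe_real.
rewrite !eigenvalue_root_char -map_char_poly fmorph_root => aP.
by exists a; rewrite eigenvalue_root_char.
Qed.

(* The reflection exchanging the unit vectors v and e_0; when v = e_0 the
   division by zero yields the identity, as it should. *)
Lemma householder (R : rcfType) m (v : 'rV[R]_m.+1) : v *m v^T = 1%:M ->
  exists H : 'M[R]_m.+1, [/\ H^T = H, H *m H = 1%:M & row 0 H = v].
Proof.
move=> vv; pose w := v - delta_mx 0 0; pose c := 2 / (w *m w^T) 0 0.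
have wwE : (w *m w^T) 0 0 = 2 - 2 * v 0 0.
  rewrite mulmxBl linearB /= !mulmxBr vv !mxE.
  rewrite (bigD1 0) //= big1 => [|j j0]; last first.
    by rewrite !mxE (negPf j0) mulr0.
  rewrite (bigD1 0) //= big1 => [|j j0]; last first.
    by rewrite !mxE (negPf j0) mul0r.
  rewrite (bigD1 0) //= big1 => [|j j0]; last first.
    by rewrite !mxE (negPf j0) mul0r.
  by rewrite !mxE !eqxx /=; ring.
pose H := 1%:M - c *: (w^T *m w).
have w0 : c * ((w *m w^T) 0 0) = 2 \/ w = 0.
  have [ww0|ww0] := eqVneq ((w *m w^T) 0 0) 0; last by left; rewrite divfK.
  right; apply/rowP => j; rewrite [RHS]mxE; move/eqP: ww0; rewrite mxE psumr_eq0.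
    move=> /allP/(_ j); rewrite mem_index_enum => /(_ isT) /=.
    by rewrite [w^T j 0]mxE mulf_eq0 orbb => /eqP.
  by move=> k _; rewrite [w^T k 0]mxE -expr2 sqr_ge0.
have wE : w = v - delta_mx 0 0 by [].
clearbody w; exists H; split.
- by rewrite /H linearB /= trmx1 linearZ /= trmx_mul trmxK.
- rewrite /H mulmxBl !mulmxBr !mul1mx mulmx1 -scalemxAl -scalemxAr scalerA.
  rewrite mulmxA -[w^T *m w *m w^T]mulmxA [w *m w^T]mx11_scalar mul_mx_scalar.
  rewrite -scalemxAl scalerA; case: w0 => [e|->]; last first.
    by rewrite !trmx0 !mul0mx !scaler0 !subr0.
  rewrite -mulrA e opprB addrA; apply/matrixP => i j; rewrite !mxE; ring.
- have e0 : row 0 (c *: (w^T *m w)) = - w.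
    apply/rowP => j; rewrite !mxE big_ord1 !mxE.
    case: w0 => [|w0]; last first.
      by move/rowP: (w0) => /(_ j); rewrite !mxE => ->; rewrite mulr0 !mulr0 oppr0.
    have w00 : w 0 0 = v 0 0 - 1 by rewrite wE !mxE !eqxx.
    (* As v is a unit vector, |w|^2 = -2 w_00, so c |w|^2 = 2 becomes c w_00 = -1. *)
    rewrite wwE => e; rewrite mulrA (_ : c * _ = -1) ?mulN1r // w00; lra.
  by rewrite /H linearB /= e0 opprK wE row1 addrC subrK.
Qed.

(** Induction on the size: conjugation by a reflection whose first row is a unit eigenvector splits
    off a 1 x 1 block. The rows of [P] are the eigenvectors. *)
Lemma symmetric_spectral (R : rcfType) m (S : 'M[R]_m) : S^T = S ->
  exists (P : 'M[R]_m) (d : 'rV[R]_m),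
    [/\ P *m P^T = 1%:M, P^T *m P = 1%:M & P *m S = diag_mx d *m P].
Proof.
move=> Ssym; suff: exists (P : 'M[R]_m) (d : 'rV[R]_m),
    P *m P^T = 1%:M /\ P *m S = diag_mx d *m P.
  by move=> [P [d [PP PS]]]; exists P, d; split=> //; apply: mulmx1C.
elim: m S Ssym => [|m IHm] S Ssym.
  by exists 1%:M, 0; split; rewrite [LHS]flatmx0 [RHS]flatmx0.
have [a /eigenvalueP[u uS u0]] := symmetric_eigenvalue _ _ _ Ssym.
have [v vS vv] : exists2 v : 'rV[R]_m.+1, v *m S = a *: v & v *m v^T = 1%:M.
  have uu : 0 < (u *m u^T) 0 0.
    rewrite mxE lt0r sumr_ge0 => [|j _]; last by rewrite mxE -expr2 sqr_ge0.
    rewrite andbT; apply: contraNneq u0 => /eqP; rewrite psumr_eq0 => [|j _].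
      move=> /allP uj; apply/eqP/rowP => j; have := uj j.
      by rewrite mem_index_enum mxE mulf_eq0 orbb [RHS]mxE => /(_ isT)/eqP.
    by rewrite mxE -expr2 sqr_ge0.
  exists ((Num.sqrt ((u *m u^T) 0 0))^-1 *: u).
    by rewrite -scalemxAl uS !scalerA mulrC.
  rewrite linearZ /= -scalemxAl -scalemxAr scalerA -invfM -expr2 sqr_sqrtr ?ltW //.
  by rewrite {2}[u *m u^T]mx11_scalar scale_scalar_mx mulVf ?gt_eqF.
have [H [Hsym HH H0]] := householder R m v vv.
pose S1 : 'M_(1 + m) := H *m S *m H.
have S1sym : S1^T = S1 by rewrite !trmx_mul Hsym Ssym mulmxA.
have S1row : row 0 S1 = a *: delta_mx 0 0.
  by rewrite !row_mul H0 vS -scalemxAl -H0 -row_mul HH row1.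
(* The first row of [S1] is a multiple of the first unit vector; symmetry gives the same for the
   first column. *)
have S1E : S1 = block_mx a%:M 0 0 (drsubmx S1).
  have ur : ursubmx S1 = 0.
    apply/matrixP => i j; move/rowP: S1row => /(_ (rshift 1 j)).
    rewrite !mxE (_ : lshift m i = 0); last by apply/val_inj; rewrite /= ord1.
    by move=> ->; rewrite mulr0.
  rewrite -[LHS]submxK ur; congr block_mx.
    apply/matrixP => i j; move/rowP: S1row => /(_ 0).
    rewrite !mxE !ord1 (_ : lshift m 0 = 0); last exact/val_inj.
    by move=> ->; rewrite !eqxx mulr1.
  by rewrite -[LHS]trmxK trmx_dlsub S1sym ur trmx0.
have [|Q [d [QQ QS]]] := IHm (drsubmx S1); first by rewrite trmx_drsub S1sym.
pose B : 'M_(1 + m) := block_mx 1%:M 0 0 Q.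
have BB : B *m B^T = 1%:M.
  rewrite /B tr_block_mx !trmx0 trmx1 mulmx_block !mulmx0 !mul0mx !addr0 !add0r.
  by rewrite QQ mulmx1 -scalar_mx_block.
have BS : B *m S1 = diag_mx (row_mx (a%:M : 'rV_1) d) *m B.
  rewrite /B diag_mx_row S1E !mulmx_block !mulmx0 !mul0mx !addr0 !add0r.
  rewrite QS mul1mx mulmx1; congr block_mx.
  by apply/matrixP => i j; rewrite !mxE !ord1.
exists (B *m H), (row_mx (a%:M : 'rV_1) d); split.
  by rewrite trmx_mul Hsym mulmxA -[B *m H *m H]mulmxA HH mulmx1.
by rewrite [RHS]mulmxA -BS /S1 !mulmxA -[RHS]mulmxA HH mulmx1.
Qed.

(** With [mu] the degree in the domain, this is the inner product for which the Dirichlet-to-Neumann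
    map is self-adjoint. *)
Definition wdot (R : rcfType) (I : finType) (mu : I -> R)
    (p q : {ffun I -> R^o}) : R := \sum_v p v * q v * mu v.
Arguments wdot {R I}.

Lemma wdotC (R : rcfType) (I : finType) (mu : I -> R) p q :
  wdot mu p q = wdot mu q p.
Proof. by apply: eq_bigr => v _; rewrite [p v * _]mulrC. Qed.

Lemma wdot_suml (R : rcfType) (I : finType) (mu : I -> R) (J : finType)
    (a : J -> R) (p : J -> {ffun I -> R^o}) q :
  wdot mu (\sum_j a j *: p j) q = \sum_j a j * wdot mu (p j) q.
Proof.
rewrite /wdot; under [RHS]eq_bigr => j _ do rewrite mulr_sumr.
rewrite exchange_big; apply: eq_bigr => v _.
rewrite sum_ffunE !mulr_suml; apply: eq_bigr => j _.
by rewrite ffunE /= -!mulrA.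
Qed.

(** In an orthonormal basis of rescaled indicator functions the operator has a symmetric matrix; the
    rows of its diagonalizing matrix are the coordinates of the eigenvectors. *)
Lemma self_adjoint_spectral (R : rcfType) (I : finType) (mu : I -> R)
    (f : 'End({ffun I -> R^o})) :
  (forall v, 0 < mu v) ->
  (forall p q, wdot mu (f p) q = wdot mu p (f q)) ->
  exists (e : 'I_#|I| -> {ffun I -> R^o}) (d : 'I_#|I| -> R),
    [/\ forall k, f (e k) = d k *: e k,
        forall k l, wdot mu (e k) (e l) = (k == l)%:R
      & forall p, p = \sum_k wdot mu p (e k) *: e k].
Proof.
move=> mu0 fsym; pose dot := wdot mu.
(* The indicator of a point v has squared norm [mu v], hence the division by its square root. *)
pose b (i : 'I_#|I|) : {ffun I -> R^o} :=
  [ffun v => (v == enum_val i)%:R / Num.sqrt (mu v)].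
have dotb p i : dot p (b i) = p (enum_val i) * Num.sqrt (mu (enum_val i)).
  rewrite /dot /wdot (bigD1 (enum_val i)) //= big1 ?addr0 => [|v vi]; last first.
    by rewrite ffunE (negPf vi) mul0r mulr0 mul0r.
  rewrite ffunE eqxx div1r -mulrA; congr (_ * _).
  by rewrite -{2}(sqr_sqrtr (ltW (mu0 _))) expr2 mulKf // gt_eqF // sqrtr_gt0.
have bE p : p = \sum_i dot p (b i) *: b i.
  apply/ffunP => v; rewrite sum_ffunE (bigD1 (enum_rank v)) //=.
  rewrite big1 ?addr0 => [|i iv]; last first.
    rewrite !ffunE /= -(inj_eq enum_rank_inj) enum_valK eq_sym (negPf iv).
    by rewrite mul0r scaler0.
  rewrite !ffunE /= dotb enum_rankK eqxx div1r [RHS]mulfK // gt_eqF //.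
  by rewrite sqrtr_gt0.
have bb i j : dot (b i) (b j) = (i == j)%:R.
  rewrite dotb ffunE (inj_eq enum_val_inj) eq_sym divfK // gt_eqF //.
  by rewrite sqrtr_gt0.
pose S := \matrix_(i, j) dot (f (b i)) (b j).
have [|P [d [PP PtP PS]]] := symmetric_spectral R _ S.
  by apply/matrixP => i j; rewrite !mxE /dot fsym wdotC.
pose e k := \sum_i P k i *: b i.
have dote p k : dot p (e k) = \sum_i P k i * dot p (b i).
  rewrite /dot wdotC wdot_suml; apply: eq_bigr => i _.
  by rewrite wdotC.
exists e, (d 0); split=> [k|k l|p].
- rewrite linear_sum scaler_sumr.
  have -> : \sum_i f (P k i *: b i) = \sum_j (P *m S) k j *: b j.
    under eq_bigr => i _ do rewrite linearZ /= [f (b i)]bE scaler_sumr.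
    rewrite exchange_big; apply: eq_bigr => j _ /=.
    rewrite mxE scaler_suml; apply: eq_bigr => i _.
    by rewrite scalerA mxE.
  by rewrite PS; apply: eq_bigr => j _; rewrite mul_diag_mx !mxE scalerA.
- rewrite -/(dot _ _) dote; have /matrixP/(_ l k) := PP; rewrite !mxE eq_sym => <-.
  apply: eq_bigr => i _; rewrite mxE; congr (_ * _).
  rewrite /dot wdot_suml (bigD1 i) //= big1 => [|j ji].
    by rewrite -/(dot _ _) bb eqxx mulr1 addr0.
  by rewrite -/(dot _ _) bb (negPf ji) mulr0.
(* Orthonormality came from [P *m P^T = 1%:M]; completeness comes from [P^T *m P = 1%:M]. *)
- rewrite {1}[p]bE.
  under [RHS]eq_bigr => k _.
    rewrite -/(dot _ _) dote /e scaler_sumr.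
    under eq_bigr => j _ do rewrite scalerA mulr_suml scaler_suml.
    over.
  rewrite exchange_big; apply: eq_bigr => j _ /=.
  rewrite exchange_big /= (bigD1 j) //= [X in _ = _ + X]big1 => [|i ij].
    rewrite addr0 -scaler_suml; congr (_ *: _).
    under [RHS]eq_bigr => k _ do rewrite mulrAC.
    have /matrixP/(_ j j) := PtP; rewrite !mxE eqxx -mulr_suml => PP1.
    rewrite -[LHS]mul1r -[1]PP1; congr (_ * _).
    by apply: eq_bigr => k _; rewrite mxE.
  rewrite -scaler_suml; under eq_bigr => k _ do rewrite mulrAC.
  rewrite -mulr_suml; have /matrixP/(_ i j) := PtP; rewrite !mxE (negPf ij).
  under eq_bigr => k _ do rewrite mxE.
  by move=> ->; rewrite mul0r scale0r.
Qed.

(** An eigenvector for [a], expanded in the eigenbasis, has zero coordinates wherever [d k != a]; so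
    the eigenspace is spanned by the remaining basis vectors, which are free. *)
Lemma dim_leigenspace (F : fieldType) (vT : vectType F) m (f : 'End(vT))
    (e : 'I_m -> vT) (d : 'I_m -> F) :
  basis_of fullv [seq e k | k <- enum 'I_m] ->
  (forall k, f (e k) = d k *: e k) ->
  forall a, \dim (passmx.leigenspace f a) = count_mem a [seq d k | k <- enum 'I_m].
Proof.
move=> eB fe a; pose D := [seq k <- enum 'I_m | d k == a].
have eF : free [seq e k | k <- D].
  have /permEl/(perm_map e) := perm_filterC (fun k => d k == a) (enum 'I_m).
  rewrite map_cat => /perm_free eq_free.
  by move: (basis_free eB); rewrite -eq_free => /catl_free.
have -> : passmx.leigenspace f a = <<[seq e k | k <- D]>>%VS.
  apply/eqP; rewrite eqEsubv; apply/andP; split; last first.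
    apply/span_subvP => u /mapP[k kD ->]; move: kD.
    rewrite mem_filter => /andP[/eqP dk _].
    by rewrite memv_ker add_lfunE opp_lfunE scale_lfunE id_lfunE fe dk subrr.
  apply/subvP => v; rewrite memv_ker.
  pose X := map_tuple e (ord_tuple m).
  have Xi (i : 'I_m) : X`_i = e i by rewrite -tnth_nth tnth_map tnth_ord_tuple.
  have XE : X = [seq e k | k <- enum 'I_m] :> seq vT by [].
  have vE : v = \sum_i coord X i v *: e i.
    rewrite {1}(coord_basis (X := X) (U := fullv) _ (v := v)) ?memvf ?XE //.
    by apply: eq_bigr => i _; rewrite Xi.
  have -> : (f - a *: \1%VF) v = \sum_i (coord X i v * (d i - a)) *: X`_i.
    rewrite {1}vE linear_sum; apply: eq_bigr => i _.
    rewrite linearZ /= add_lfunE opp_lfunE scale_lfunE id_lfunE fe Xi.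
    by rewrite -scalerBl scalerA.
  have /freeP X_free : free X by rewrite XE (basis_free eB).
  move=> /eqP /X_free v0.
  have {}v0 i : d i != a -> coord X i v = 0.
    move=> dia; have /eqP := v0 i; rewrite mulf_eq0 subr_eq0 (negPf dia) orbF.
    by move=> /eqP.
  rewrite vE; apply: memv_suml => i _; have [dia|/v0 ->] := eqVneq (d i) a.
    apply/memvZ/memv_span/map_f.
    by rewrite mem_filter dia eqxx mem_enum.
  by rewrite scale0r mem0v.
have -> : \dim <<[seq e k | k <- D]>>%VS = size [seq e k | k <- D].
  by apply/eqP.
by rewrite size_map size_filter [RHS]count_map.
Qed.

(** * Ky Fan's principle for the smallest positive eigenvalues *)

(** Weights in [0, 1] of total [n] give the least weighted sum when they are 1 on the [n] smallest
    values: moving weight across a threshold separating these values from the others can only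
    increase the sum. *)
Lemma sum_smallest_le (R : realFieldType) (T : Type) (d p : T -> R) (ks : seq T) n :
  sorted <=%R [seq d k | k <- ks] -> (forall k, 0 <= p k <= 1) ->
  \sum_(k <- ks) p k = n%:R ->
  (n <= size ks)%N /\
  \sum_(i < n) [seq d k | k <- ks]`_i <= \sum_(k <- ks) p k * d k.
Proof.
move=> ks_sorted p01 sum_p.
have n_le : (n <= size ks)%N.
  rewrite -(ler_nat R) -sum_p -sum1_size natr_sum.
  by apply: ler_sum => k _; case/andP: (p01 k).
split=> //; have -> : \sum_(i < n) [seq d k | k <- ks]`_i =
    \sum_(k <- take n ks) d k.
  rewrite -(big_map d xpredT id) map_take (big_nth 0) size_takel ?size_map //.
  by rewrite big_mkord; apply: eq_bigr => i _; rewrite nth_take.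
(* The threshold is the largest of the first [n] values; for [n = 0] it is the head of the list, or
   0 if the list is empty. *)
have [t t_ge t_le] : exists2 t, all (fun k => d k <= t) (take n ks) &
    all (fun k => t <= d k) (drop n ks).
  case: n {sum_p} n_le => [|n] n_le.
    rewrite take0 drop0; case: ks ks_sorted {n_le} => [|k ks]; first by exists 0.
    rewrite /= (path_sortedE le_trans) all_map => /andP[kP _].
    by exists (d k); rewrite //= lexx.
  exists ([seq d k | k <- ks]`_n).
    rewrite -(all_map d (fun x => x <= _)) map_take.
    apply/(all_nthP 0) => i; rewrite size_takel ?size_map // => i_lt.
    rewrite nth_take //; apply: (sorted_leq_nth le_trans lexx) => //.
      by rewrite inE size_map (leq_trans i_lt).
    by rewrite inE size_map.
  rewrite -(all_map d (fun x => _ <= x)) map_drop.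
  apply/(all_nthP 0) => i; rewrite size_drop size_map => i_lt.
  rewrite nth_drop; apply: (sorted_leq_nth le_trans lexx) => //.
  - by rewrite inE size_map.
  - by rewrite inE size_map -ltn_subRL.
  - by rewrite addSn ltnW // ltnS leq_addr.
rewrite -subr_ge0.
(* The terms in [t] cancel, because the weight missing on the first [n] entries equals the weight
   present on the others. *)
have -> : \sum_(k <- ks) p k * d k - \sum_(k <- take n ks) d k =
    \sum_(k <- take n ks) (1 - p k) * (t - d k) +
    \sum_(k <- drop n ks) p k * (d k - t).
  have sum_p' : \sum_(k <- take n ks) p k + \sum_(k <- drop n ks) p k =
      \sum_(k <- take n ks) 1.
    rewrite -big_cat cat_take_drop sum_p -{1}(size_takel n_le).
    by rewrite -sum1_size natr_sum.
  rewrite -{1}(cat_take_drop n ks) big_cat /=.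
  have E k : (1 - p k) * (t - d k) = 1 * t - p k * t + (p k * d k - d k).
    by ring.
  under [in RHS]eq_bigr => k _ do rewrite E.
  under [X in _ = _ + X]eq_bigr => k _ do rewrite mulrBr.
  rewrite !big_split /= !sumrN -!mulr_suml -sum_p'; ring.
apply: addr_ge0.
  elim: (take n ks) t_ge => [|k s IHs] /=; rewrite ?big_nil // big_cons.
  move=> /andP[dk /IHs]; apply: addr_ge0.
  by case/andP: (p01 k) => _ p1; rewrite mulr_ge0 ?subr_ge0.
elim: (drop n ks) t_le => [|k s IHs] /=; rewrite ?big_nil // big_cons.
move=> /andP[dk /IHs]; apply: addr_ge0.
by case/andP: (p01 k) => p0 _; rewrite mulr_ge0 ?subr_ge0.
Qed.

(** Ky Fan's principle with the square root of [f] eliminated: the eigenvector [e k] receives the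
    weight [d k * g k]. These weights lie in [0, 1], sum to [n], and turn the weighted sum of the
    eigenvalues into the right-hand side. *)
Lemma sum_smallest_eigenvalues_le (R : realType) (I : finType) (mu : I -> R)
    (f : 'End({ffun I -> R^o})) n (x : 'I_n -> {ffun I -> R^o}) (E : 'I_n -> R) :
  (forall v, 0 < mu v) ->
  (forall p q, wdot mu (f p) q = wdot mu p (f q)) ->
  (forall p, 0 <= wdot mu (f p) p) ->
  (forall i, 0 < E i) ->
  (forall i j, wdot mu (f (x i)) (x j) = if i == j then E i else 0) ->
  exists lambda : seq R,
    [/\ positive_eigenvalues f lambda, (n <= size lambda)%N &
        \sum_(i < n) lambda`_i <= \sum_(i < n) wdot mu (f (x i)) (f (x i)) / E i].
Proof.
move=> mu0 fsym fge0 E0 fx; pose dot := wdot mu.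
have [e [d [fe ee eE]]] := self_adjoint_spectral _ _ _ f mu0 fsym.
have parseval p q : dot p q = \sum_k dot p (e k) * dot q (e k).
  rewrite {1}(eE p) /dot wdot_suml; apply: eq_bigr => k _.
  by rewrite [wdot _ (e k) q]wdotC.
have dotf p k : dot (f p) (e k) = d k * dot p (e k).
  rewrite /dot fsym fe /wdot mulr_sumr; apply: eq_bigr => v _.
  by rewrite ffunE -[_ *: _]/(d k * e k v); ring.
have d0 k : 0 <= d k.
  by have := fge0 (e k); rewrite -/(dot _ _) dotf /dot ee eqxx mulr1.
have eB : basis_of fullv [seq e k | k <- enum 'I_#|I|].
  rewrite basisEdim size_map size_enum_ord dimvf /dim /= muln1 leqnn andbT.
  apply/subvP => p _; rewrite (eE p); apply: memv_suml => k _.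
  by apply/memvZ/memv_span/map_f; rewrite mem_enum.
pose c i k := dot (x i) (e k).
have sum_c i j : \sum_k d k * (c i k * c j k) = if i == j then E i else 0.
  rewrite -fx -/(dot _ _) parseval; apply: eq_bigr => k _.
  by rewrite dotf mulrA.
(* d k * g k is the squared length of the projection of e k onto the span of
   the orthonormal vectors f^(1/2) (x i) / sqrt (E i); it is at most 1. *)
pose g k := \sum_i c i k ^+ 2 / E i.
have g0 k : 0 <= g k by apply: sumr_ge0 => i _; rewrite divr_ge0 ?sqr_ge0 ?ltW.
have dg_le k : d k * g k ^+ 2 <= g k.
  (* Bessel's inequality: the vector \sum_i w i *: x i has energy [g k], and the term j = k of its
     spectral expansion is [d k * g k ^+ 2]. *)
  pose w i := c i k / E i.
  have : \sum_j d j * (\sum_i w i * c i j) ^+ 2 = g k.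
    under eq_bigr => j _.
      rewrite expr2 mulr_suml mulr_sumr.
      under eq_bigr => i _ do rewrite mulr_sumr mulr_sumr.
      over.
    rewrite exchange_big; apply: eq_bigr => i _ /=; rewrite exchange_big /=.
    rewrite (bigD1 i) //= [X in _ + X]big1 ?addr0 => [|l li].
      transitivity (\sum_j w i ^+ 2 * (d j * (c i j * c i j))).
        by apply: eq_bigr => j _; ring.
      rewrite -mulr_sumr sum_c eqxx /w; field.
      by rewrite gt_eqF.
    transitivity (\sum_j (w i * w l) * (d j * (c i j * c l j))).
      by apply: eq_bigr => j _; ring.
    by rewrite -mulr_sumr sum_c eq_sym (negPf li) mulr0.
  rewrite (bigD1 k) //= => gE; rewrite -[leRHS]gE.
  have -> : \sum_i w i * c i k = g k.
    by apply: eq_bigr => i _; rewrite /w; ring.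
  by rewrite lerDl sumr_ge0 // => j _; rewrite mulr_ge0 ?sqr_ge0.
have p01 k : 0 <= d k * g k <= 1.
  rewrite mulr_ge0 //=; have := dg_le k; have := g0 k.
  rewrite le_eqVlt => /predU1P[<- _|gk]; first by rewrite mulr0 ler01.
  by rewrite expr2 mulrA -[X in _ <= X -> _]mul1r ler_pM2r.
have sum_p : \sum_k d k * g k = n%:R.
  under eq_bigr => k _ do rewrite mulr_sumr.
  rewrite exchange_big /=.
  transitivity (\sum_(i < n) (1 : R)); last by rewrite sumr_const card_ord.
  apply: eq_bigr => i _.
  transitivity ((\sum_k d k * (c i k * c i k)) / E i).
    by rewrite mulr_suml; apply: eq_bigr => k _; ring.
  by rewrite sum_c eqxx divff // gt_eqF.
(* Zero eigenvalues carry zero weight, so the total weight on the positive ones is still [n]; this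
   forces at least [n] of them to exist. *)
pose ks := sort (relpre d <=%R) [seq k <- enum 'I_#|I| | 0 < d k].
have sum_ks (F : 'I_#|I| -> R) : (forall k, d k = 0 -> F k = 0) ->
    \sum_(k <- ks) F k = \sum_k F k.
  move=> F0; rewrite (perm_big [seq k <- enum 'I_#|I| | 0 < d k]) /=; last first.
    by rewrite perm_sort.
  rewrite big_filter big_enum_cond /= [RHS](bigID (fun k => 0 < d k)) /=.
  rewrite [X in _ = _ + X]big1 ?addr0 // => k; rewrite lt_neqAle d0 andbT negbK.
  by move=> /eqP dk; apply: F0.
have ksE : [seq d k | k <- ks] =
    sort <=%R [seq x <- [seq d k | k <- enum 'I_#|I|] | 0 < x].
  by rewrite filter_map sort_map.
have ks_sorted : sorted <=%R [seq d k | k <- ks].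
  by rewrite ksE sort_sorted //; exact: le_total.
have [|n_le sum_le] := sum_smallest_le _ _ d (fun k => d k * g k) ks n ks_sorted p01.
  by rewrite sum_ks // => k ->; rewrite mul0r.
exists [seq d k | k <- ks]; split; [split=> // a| by rewrite size_map|].
- rewrite ksE (permP (permEl (perm_sort _ _))) count_filter.
  have [a0|a0] := ifPn.
    rewrite (dim_leigenspace _ _ _ _ e d) //.
    by apply: eq_count => b /=; case: eqP => // ->; rewrite a0.
  apply/eqP; rewrite -leqn0 leqNgt -has_count; apply/hasPn => b _ /=.
  by apply: contraNN a0 => /andP[/eqP <-].
apply: le_trans sum_le _; rewrite sum_ks => [|k ->]; last by rewrite !mul0r.
rewrite le_eqVlt; apply/orP; left; apply/eqP.
under eq_bigr => k _ do rewrite mulr_sumr mulr_suml.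
rewrite exchange_big; apply: eq_bigr => i _ /=.
rewrite -/(dot _ _) parseval mulr_suml; apply: eq_bigr => k _.
by rewrite dotf -/(c i k); ring.
Qed.

(** * Edges of a lattice domain *)

Lemma Zadj_sub_basis n (x : 'rV[int]_n) i : Zadj x (x - basis_vec i).
Proof. by have := Zadj_add_basis (x - basis_vec i) i; rewrite subrK Zadj_sym. Qed.

Lemma Zadj_coordE n (x y : 'rV[int]_n) i :
  Zadj x y -> x 0 i - y 0 i = (y == x - basis_vec i)%:R - (y == x + basis_vec i)%:R.
Proof.
have basis_neq j : (basis_vec j : 'rV[int]_n) != - basis_vec i.
  apply/eqP => /rowP/(_ j); rewrite !mxE !eqxx /=.
  by case: (j == i).
have basis_inj j : ((basis_vec j : 'rV[int]_n) == basis_vec i) = (i == j).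
  apply/eqP/eqP => [/rowP/(_ i)|->] //; rewrite !mxE !eqxx /=.
  by case: eqP.
move=> /Zadj_basis[j [] ->].
  rewrite !(inj_eq (addrI x)) (negPf (basis_neq j)) basis_inj !mxE eqxx /=.
  by rewrite opprD addNKr sub0r.
rewrite !(inj_eq (addrI x)) (inj_eq oppr_inj) basis_inj eqr_oppLR.
by rewrite (negPf (basis_neq j)) !mxE eqxx /= opprB addrC subrK subr0.
Qed.

Lemma sum_eq_mem (R : pzSemiRingType) (K : choiceType) (A : {fset K}) (a : K) :
  \sum_(y : A) (val y == a)%:R = (a \in A)%:R :> R.
Proof.
have [aA|aA] := boolP (a \in A); last first.
  rewrite big1 // => y _; case: eqP => // ya.
  by rewrite -ya (valP y) in aA.
rewrite (bigD1 [` aA]) //= eqxx big1 ?addr0 // => y.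
by rewrite -val_eqE /= => /negPf ->.
Qed.

(** Among the neighbours of [v] only v - e_i and v + e_i differ from it in coordinate i; all others
    contribute [h 0]. The uses take [h] to be the embedding of the integers (harmonicity, normal
    derivative) or its square (degree). *)
Lemma sum_Zadj (R : pzRingType) n (A : {fset 'rV[int]_n}) v i (h : int -> R) :
  h 0 = 0 ->
  \sum_(y : A | Zadj v (val y)) h (v 0 i - val y 0 i) =
  (v - basis_vec i \in A)%:R * h 1 + (v + basis_vec i \in A)%:R * h (-1).
Proof.
move=> h0; rewrite -!sum_eq_mem !mulr_suml -big_split big_mkcond /=.
apply: eq_bigr => y _; case: ifP => [vy|vy].
  rewrite Zadj_coordE //.
  case: eqP => [->|_]; last by case: eqP => _; rewrite ?mul0r ?mul1r ?add0r ?sub0r.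
  case: eqP => [|_]; last by rewrite mul1r mul0r subr0 addr0.
  by move=> /addrI/rowP/(_ i); rewrite !mxE !eqxx.
case: eqP => [e|_]; first by rewrite e Zadj_sub_basis in vy.
case: eqP => [e|_]; first by rewrite e Zadj_add_basis in vy.
by rewrite !mul0r addr0.
Qed.

Section LatticeDomain.
Variables (n : nat) (Omega : {fset 'rV[int]_n}).
Implicit Types (x y v : 'rV[int]_n) (i : 'I_n).

Lemma Zadj_irrefl x : Zadj x x = false.
Proof.
by apply/negbTE; rewrite /Zadj big1 // => i _; rewrite subrr normr0.
Qed.

Lemma tadjC x y : tadj Omega x y = tadj Omega y x.
Proof. by rewrite /tadj fsetUC. Qed.

Lemma tadjP x y : tadj Omega x y = Zadj x y && ((x \in Omega) || (y \in Omega)).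
Proof.
have [xO|xO] := boolP (x \in Omega); first by rewrite tadjE // andbT.
have [yO|yO] := boolP (y \in Omega); first by rewrite tadjC tadjE // Zadj_sym andbT.
rewrite andbF; apply/negbTE; apply: contra xO => /imfset2P[a aO [b _ e]].
have : a \in [fset x; y] by rewrite e !inE eqxx.
rewrite !inE => /orP[/eqP <- //|/eqP ay]; by rewrite -ay aO in yO.
Qed.

Lemma tadj_clos x y : tadj Omega x y -> y \in clos Omega.
Proof.
rewrite tadjP => /andP[xy /orP[xO|yO]]; first exact: clos_nbr xO xy.
by rewrite in_fsetU yO.
Qed.

Lemma tadj_bdry x y : x \in bdry Omega -> y \in bdry Omega -> tadj Omega x y = false.
Proof.
by rewrite tadjP !in_bdry => /andP[/negPf -> _] /andP[/negPf -> _]; rewrite andbF.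
Qed.

(** The map sending y to {v, y} is a bijection from the neighbours of [v] to the edges at [v]. The
    predicate [Q] covers both the full degree and the degree in one direction. *)
Lemma card_incident_edges (Q : pred {fset 'rV[int]_n}) v :
  #|` [fset e in edges Omega | Q e && (v \in e)]| =
  (\sum_(y : clos Omega | tadj Omega v (val y)) Q [fset v; val y])%N.
Proof.
pose N := [fset val y | y : clos Omega & tadj Omega v (val y) && Q [fset v; val y]].
have -> : [fset e in edges Omega | Q e && (v \in e)] = [fset [fset v; y] | y in N].
  apply/fsetP => e; apply/idP/imfsetP => /= [|[y /imfsetP[z /=]]]; last first.
    rewrite inE => /andP[vz Qz] -> ->; rewrite !inE /= Qz eqxx andbT.
    exact: vz.
  rewrite !inE /= => /and3P[eE Qe ve].
  have [y ey] : exists y, e = [fset v; y].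
    have /imfset2P[a _ [b _ e_ab]] := eE.
    move: ve; rewrite e_ab !inE => /orP[]/eqP ->; first by exists b.
    by exists a; rewrite fsetUC.
  have vy : tadj Omega v y by rewrite /tadj -ey.
  exists y => //; apply/imfsetP; exists [` tadj_clos _ _ vy] => //=.
  by rewrite inE vy -ey.
rewrite card_imfset /=; last first.
  move=> y z /fsetP e; have := e y; rewrite !inE eqxx orbT => /esym/orP[]/eqP // yv.
  by have := e z; rewrite !inE eqxx orbT yv orbb => /eqP.
rewrite card_imfset //=; last exact: val_inj.
rewrite -sum1_size big_filter big_enum_cond big_mkcondr.
rewrite [RHS]big_mkcond; apply: eq_big => [y|y _]; first by rewrite ?inE.
by case: (tadj _ _ _); case: (Q _).
Qed.

(** The ends of an edge differ by e_j or -e_j for a single j, and both sides say that i = j. *)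
Lemma parallelE i x y : Zadj x y -> parallel i [fset x; y] = (x 0 i != y 0 i).
Proof.
move=> xy.
have -> : parallel i [fset x; y] = (x - y == (x - y) 0 i *: basis_vec i).
  have xI : x \in [fset x; y] by rewrite !inE eqxx.
  have yI : y \in [fset x; y] by rewrite !inE eqxx orbT.
  apply/forallP/eqP => [/(_ [` xI])/forallP/(_ [` yI])/eqP //|xyi a].
  apply/forallP => b; apply/eqP.
  have := valP a; have := valP b; rewrite !inE => /orP[]/eqP -> /orP[]/eqP ->.
  - by rewrite subrr mxE scale0r.
  - by rewrite -[y - x]opprB {1}xyi [in RHS]mxE scaleNr.
  - exact: xyi.
  - by rewrite subrr mxE scale0r.
have [j xyj] : exists j, x - y = - basis_vec j \/ x - y = basis_vec j.
  have [j [->|->]] := Zadj_basis xy; exists j; [left|right].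
    by rewrite opprD addNKr.
  by rewrite opprB addrC subrK.
have -> : (x 0 i != y 0 i) = ((x - y) 0 i != 0) by rewrite !mxE subr_eq0.
have basis_neq0 : basis_vec j != 0 :> 'rV[int]_n.
  by apply/eqP => /rowP/(_ j); rewrite !mxE !eqxx.
case: xyj => ->; rewrite mxE ?mxE eqxx /=; have [->|ij] := eqVneq i j.
- by rewrite scaleN1r eqxx.
- by rewrite oppr0 scale0r eqxx oppr_eq0 (negPf basis_neq0).
- by rewrite scale1r eqxx.
- by rewrite scale0r eqxx (negPf basis_neq0).
Qed.

Lemma sum_clos (R : nmodType) (P : pred (clos Omega)) (F : clos Omega -> R) :
  \sum_(z | P z) F z =
  \sum_(u : Omega | P (clos_in u)) F (clos_in u) +
  \sum_(v : bdry Omega | P (clos_bdry v)) F (clos_bdry v).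
Proof.
rewrite (bigID (fun z => val z \in Omega)) /=; congr (_ + _).
  rewrite (reindex_omap (@clos_in n Omega) (fun z => insub (val z))) /=.
    by apply: eq_bigl => u; rewrite (valP u) andbT valK eqxx andbT.
  by move=> z /andP[_ zO]; rewrite insubT /=; congr Some; apply: val_inj.
rewrite (reindex_omap (@clos_bdry n Omega) (fun z => insub (val z))) /=.
  apply: eq_bigl => v; rewrite valK eqxx andbT.
  by have := valP v; rewrite in_bdry => /andP[-> _]; rewrite andbT.
move=> z /andP[_ zO]; have zB : val z \in bdry Omega.
  by have := valP z; rewrite in_fsetU (negPf zO).
by rewrite insubT /=; congr Some; apply: val_inj.
Qed.

(** Along an edge, coordinate i changes by 0, 1 or -1, so the squared increment is the indicator of
    being parallel to e_i. *)
Lemma sum_Zadj_sqr (R : pzRingType) i v :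
  \sum_(y : clos Omega | tadj Omega v (val y)) ((v 0 i - val y 0 i)%:~R ^+ 2) =
  (deg_par Omega i v)%:R :> R.
Proof.
have -> : deg_par Omega i v =
    #|` [fset e in edges Omega | parallel i e && (v \in e)]|.
  by congr #|` _|; apply/fsetP => e; rewrite !inE /= andbA.
rewrite card_incident_edges natr_sum; apply: eq_bigr => y.
rewrite tadjP => /andP[vy _]; rewrite parallelE // -subr_eq0 Zadj_coordE //.
have [->|_] := eqVneq (val y) (v - basis_vec i).
  have [/addrI/rowP/(_ i)|_] := eqVneq _ (v + basis_vec i).
    by rewrite !mxE !eqxx.
  by rewrite subr0 expr1n.
have [_|_] := eqVneq _ (v + basis_vec i); first by rewrite sub0r sqrrN expr1n.
by rewrite subrr eqxx expr0n.
Qed.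

(** Each edge is parallel to exactly one coordinate axis. *)
Lemma sum_deg_par v : (\sum_i deg_par Omega i v = deg Omega v)%N.
Proof.
have -> : deg Omega v = #|` [fset e in edges Omega | predT e && (v \in e)]|.
  by congr #|` _|; apply/fsetP => e; rewrite !inE.
have deg_parE i : deg_par Omega i v =
    #|` [fset e in edges Omega | parallel i e && (v \in e)]|.
  by congr #|` _|; apply/fsetP => e; rewrite !inE /= andbA.
under eq_bigr => i _ do rewrite deg_parE card_incident_edges.
rewrite card_incident_edges exchange_big; apply: eq_bigr => y.
rewrite tadjP => /andP[vy _]; under eq_bigr => i _ do rewrite parallelE //.
have [j vyj] := Zadj_basis vy; rewrite (bigD1 j) //= big1 => [|i ij].
  by case: vyj => ->; rewrite !mxE !eqxx -subr_eq0 ?opprD ?opprK addNKr.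
by case: vyj => ->; rewrite !mxE !eqxx (negPf ij) /= ?subr0 ?addr0 eqxx.
Qed.

(** Double counting of incidences: an edge has two distinct ends, both in the closure. *)
Lemma card_edges_par i :
  (\sum_(v : clos Omega) deg_par Omega i (val v) = 2 * #|` edges_par Omega i|)%N.
Proof.
have deg_parE v : deg_par Omega i v =
    (\sum_(e : edges_par Omega i) (v \in val e))%N.
  rewrite /deg_par card_fset_sum1 -big_fset_condE /=.
  by rewrite big_seq_fsetE big_mkcond; apply: eq_bigr => e _; case: (v \in _).
under eq_bigr => v _ do rewrite deg_parE.
rewrite exchange_big /= cardfE -sum1_card big_distrr /=.
apply: eq_bigr => e _; rewrite muln1.
have /imfset2P[x xO [y]] : val e \in edges Omega.
  by have := valP e; rewrite !inE => /andP[].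
rewrite inE => /andP[yO xy] ->.
have xy_neq : x != y by apply: contraTneq xy => ->; rewrite Zadj_irrefl.
have xC : x \in clos Omega by rewrite in_fsetU xO.
have -> : 2%N = #|` [fset v in clos Omega | v \in [fset x; y]]|.
  rewrite (_ : [fset v in _ | _] = [fset x; y]) ?cardfs2 ?xy_neq //.
  apply/fsetP => v; rewrite in_fset [LHS]inE /=; apply: andb_idl.
  by rewrite in_fset2 => /orP[] /eqP ->; [exact: xC | exact: yO].
rewrite card_fset_sum1 -big_fset_condE /= big_seq_fsetE [RHS]big_mkcond /=.
by apply: eq_bigr => v _; case: (_ \in _).
Qed.

Lemma edges_par_gt0 i : Omega != fset0 -> (0 < #|` edges_par Omega i|)%N.
Proof.
case/fset0Pn => x xO; have xy := Zadj_add_basis x i.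
rewrite cardfs_gt0; apply/fset0Pn; exists [fset x; x + basis_vec i].
have xy_edge : tadj Omega x (x + basis_vec i) by rewrite tadjE.
rewrite !inE /= parallelE // !mxE !eqxx -subr_eq0 opprD addNKr.
by apply/andP; split; [exact: xy_edge|].
Qed.

Lemma deg_gt0 x y : tadj Omega x y -> (0 < deg Omega x)%N.
Proof.
move=> xy; rewrite cardfs_gt0; apply/fset0Pn; exists [fset x; y].
by rewrite !inE /= eqxx andbT; exact: xy.
Qed.

Lemma deg_bdry_gt0 (v : bdry Omega) : (0 < deg Omega (val v))%N.
Proof.
have := valP v; rewrite in_bdry => /andP[_ /existsP[x xv]].
by apply: (deg_gt0 _ (val x)); rewrite tadjC tadjE ?(valP x).
Qed.

End LatticeDomain.

(** * The Dirichlet-to-Neumann map *)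

(** Linearity enters as a hypothesis, and the structure is packed inside the proof, because [DtN] is
    shown to be linear only under [0 < n]. *)
Lemma linfun_linear (F : fieldType) (aT rT : vectType F) (f : aT -> rT) :
  linear f -> linfun f =1 f.
Proof.
move=> f_lin; pose M := GRing.isLinear.Build F aT rT *:%R f f_lin.
pose g : {linear aT -> rT} := HB.pack f M.
exact: (lfunE g).
Qed.

Section DtNBound.
Variables (R : realType) (n : nat) (n_gt0 : (0 < n)%N).
Variable Omega : {fset 'rV[int]_n}.

Local Notation clos := (clos Omega).
Local Notation bdry := (bdry Omega).
Local Notation tadj := (tadj Omega).
Local Notation deg_weight := (fun v : bdry => (deg Omega (val v))%:R : R).

(** The Dirichlet form as a sum over edges: ordered pairs count every edge twice, hence the factor
    [2^-1]. *)
Definition energy (w z : {ffun clos -> R^o}) : R :=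
  2^-1 * \sum_a \sum_(b | tadj (val a) (val b)) (w a - w b) * (z a - z b).

Lemma energyC w z : energy w z = energy z w.
Proof.
by congr (_ * _); apply: eq_bigr => a _; apply: eq_bigr => b _; rewrite mulrC.
Qed.

Lemma energy_ge0 w : 0 <= energy w w.
Proof.
rewrite mulr_ge0 ?invr_ge0 //; apply: sumr_ge0 => a _; apply: sumr_ge0 => b _.
by rewrite -expr2 sqr_ge0.
Qed.

(** Summation by parts: exchange the two ends of every edge and average the two resulting
    expressions. *)
Lemma laplacian_energy (w z : {ffun clos -> R^o}) :
  \sum_a (\sum_(b | tadj (val a) (val b)) (w a - w b)) * z a = energy w z.
Proof.
pose L := \sum_a \sum_(b | tadj (val a) (val b)) (w a - w b) * z a.
have L2 : L = \sum_a \sum_(b | tadj (val a) (val b)) (w b - w a) * z b.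
  rewrite /L (exchange_big_dep xpredT) //=; apply: eq_bigr => a _.
  by apply: eq_bigl => b; rewrite tadjC.
transitivity L; first by apply: eq_bigr => a _; rewrite mulr_suml.
have : L + L = 2 * energy w z.
  rewrite {2}L2 /energy mulVKf ?pnatr_eq0 // -big_split /=.
  apply: eq_bigr => a _; rewrite -big_split /=; apply: eq_bigr => b _; ring.
lra.
Qed.

(** Green's formula, with [z] any extension of [q]: in the sum of Laplacian times [z] the interior
    terms vanish by harmonicity, and the boundary terms are normal derivatives because no edge joins
    two boundary points. *)
Lemma wdot_DtN (p q : {ffun bdry -> R^o}) (w z : {ffun clos -> R^o}) :
  harmonic_extension p w -> (forall v, z (clos_bdry v) = q v) ->
  wdot deg_weight (DtN R Omega p) q = energy w z.
Proof.
move=> hw zq; rewrite (DtNE n_gt0 hw) -laplacian_energy.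
have [w_harm wp] := hw.
rewrite sum_clos /= big1 ?add0r => [|u _]; last first.
  (* Harmonicity is stated with a factor deg^-1, which is 0 when the degree is 0; in that case the
     sum is empty. *)
  have /eqP := w_harm u; rewrite mulf_eq0 invr_eq0 pnatr_eq0.
  case/orP => [u0|/eqP ->]; last by rewrite mul0r.
  by rewrite big_pred0 ?mul0r // => y; apply/negP => /deg_gt0; rewrite (eqP u0).
apply: eq_bigr => v _; rewrite ffunE zq mulrAC [_^-1 * _]mulrC.
rewrite divfK; last by rewrite pnatr_eq0 -lt0n deg_bdry_gt0.
congr (_ * _); rewrite sum_clos /= [X in _ = _ + X]big1 ?addr0 => [|u].
  by apply: eq_big => [u|u _]; rewrite ?wp // tadjC.
by rewrite tadj_bdry ?(valP v) ?(valP u).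
Qed.

Definition coord_bdry (i : 'I_n) : {ffun bdry -> R^o} :=
  [ffun v : bdry => (val v 0 i)%:~R : R^o].
Definition coord_clos (i : 'I_n) : {ffun clos -> R^o} :=
  [ffun z : clos => (val z 0 i)%:~R : R^o].

(** The increments towards x + e_i and x - e_i cancel; both points lie in the closure since x is in
    [Omega]. *)
Lemma coord_harmonic i : harmonic_extension (coord_bdry i) (coord_clos i).
Proof.
split=> [x|v]; last by rewrite !ffunE.
rewrite (eq_bigl (fun y : clos => Zadj (val x) (val y))) => [|y]; last first.
  by rewrite tadjE ?(valP x).
rewrite (eq_bigr (fun y : clos => (val x 0 i - val y 0 i)%:~R)) => [|y _].
  rewrite (sum_Zadj R n clos (val x) i (fun z => z%:~R)) //.
  rewrite (clos_nbr (valP x) (Zadj_sub_basis _ _ _)).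
  rewrite (clos_nbr (valP x) (Zadj_add_basis _ _)).
  by rewrite !mul1r mulrNz subrr mulr0.
by rewrite !ffunE rmorphB.
Qed.

(** An edge changes only one coordinate, so mixed products vanish. For i = j the squared increments
    add up to twice the number of parallel edges, which the factor 1/2 in [energy] compensates. *)
Lemma energy_coord i j :
  energy (coord_clos i) (coord_clos j) =
  if i == j then #|` edges_par Omega i|%:R else 0.
Proof.
rewrite /energy; have [<-|ij] := eqVneq i j.
  under eq_bigr => a _.
    under eq_bigr => b _ do rewrite !ffunE /= -rmorphB -expr2.
    rewrite sum_Zadj_sqr; over.
  by rewrite -natr_sum card_edges_par natrM mulKf // pnatr_eq0.
rewrite big1 ?mulr0 // => a _; rewrite big1 // => b; rewrite tadjP => /andP[ab _].
rewrite !ffunE /= -!rmorphB -rmorphM /=.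
suff -> : (val a 0 i - val b 0 i) * (val a 0 j - val b 0 j) = 0 by [].
have [k [->|->]] := Zadj_basis ab; rewrite !mxE !eqxx /= ?opprD ?opprK !addNKr;
  have [ik|_] := eqVneq i k; rewrite ?oppr0 ?mul0r //;
  by rewrite -ik eq_sym (negPf ij) ?oppr0 mulr0.
Qed.

Lemma wdot_DtN_coord_le i :
  wdot deg_weight (DtN R Omega (coord_bdry i)) (DtN R Omega (coord_bdry i))
  <= \sum_(v : bdry) (deg Omega (val v))%:R^-1 * (deg_par Omega i (val v))%:R.
Proof.
rewrite (DtNE n_gt0 (coord_harmonic i)); apply: ler_sum => v _.
have deg0 : 0 < (deg Omega (val v))%:R :> R by rewrite ltr0n deg_bdry_gt0.
have tadj_v (u : Omega) : tadj (val u) (val v) = Zadj (val v) (val u).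
  by rewrite tadjE ?(valP u) // Zadj_sym.
rewrite !ffunE /=; set S := \sum_(u : Omega | _) _.
(* [S] is the difference of two membership bits and the degree in direction i is their sum; for
   bits, (a - b)^2 <= a + b. *)
have SE : S =
    (val v - basis_vec i \in Omega)%:R - (val v + basis_vec i \in Omega)%:R.
  rewrite /S (eq_bigl _ _ tadj_v).
  rewrite (eq_bigr (fun u : Omega => (val v 0 i - val u 0 i)%:~R)) => [|u _].
    rewrite (sum_Zadj R n Omega (val v) i (fun z => z%:~R)) //.
    by rewrite mulr1 mulrNz mulrN mulr1.
  by rewrite !ffunE rmorphB.
have dE : (deg_par Omega i (val v))%:R =
    (val v - basis_vec i \in Omega)%:R + (val v + basis_vec i \in Omega)%:R :> R.
  rewrite -sum_Zadj_sqr sum_clos /= [X in _ + X]big1 ?addr0 => [|u]; last first.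
    by rewrite tadj_bdry ?(valP v) ?(valP u).
  rewrite (eq_bigl (fun u : Omega => Zadj (val v) (val u))) => [|u]; last first.
    by rewrite tadjC tadj_v.
  rewrite (sum_Zadj R n Omega (val v) i (fun z => z%:~R ^+ 2)) ?expr0n //.
  by rewrite mulrNz sqrrN expr1n !mulr1.
have S2 : S ^+ 2 <= (deg_par Omega i (val v))%:R.
  rewrite SE dE; case: (_ \in _); case: (_ \in _);
    by rewrite ?subrr ?subr0 ?sub0r ?sqrrN ?expr0n ?expr1n ?addr0 ?add0r ?ler01 ?addr_ge0.
rewrite [leLHS](_ : _ = (deg Omega (val v))%:R^-1 * S ^+ 2); last first.
  by field; rewrite gt_eqF.
by rewrite ler_pM2l ?invr_gt0.
Qed.

End DtNBound.

(** * The eigenvalue bounds for lattice domains *)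

Theorem theorem4p1 (R : realType) (n : nat) (n_gt0 : (0 < n)%N)
    (Omega : {fset 'rV[int]_n}) (Omega_neq0 : Omega != fset0) :
  exists lambda : seq R,
    [/\ positive_eigenvalues (linfun (DtN R Omega)) lambda,
        (n <= size lambda)%N,
        \sum_(i < n) lambda`_i <=
          \sum_(v : bdry Omega) (deg Omega (val v))%:R^-1 *
            \sum_(i < n) (deg_par Omega i (val v))%:R /
                         #|` edges_par Omega i|%:R
      & \sum_(i < n) lambda`_i <=
          #|` bdry Omega|%:R /
            #|` edges_par Omega
                 [arg min_(i < Ordinal n_gt0) #|` edges_par Omega i|]|%:R].
Proof.
have DtN_fun : linfun (DtN R Omega) =1 DtN R Omega.
  by apply: linfun_linear; apply: DtN_linear.
have mu0 (v : bdry Omega) : 0 < (deg Omega (val v))%:R :> R.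
  by rewrite ltr0n deg_bdry_gt0.
have E0 i : 0 < #|` edges_par Omega i|%:R :> R by rewrite ltr0n edges_par_gt0.
(* Through this identity, symmetry, nonnegativity and the orthogonality of the coordinate functions
   are all read off from [energy]. *)
have dotE p q w z : harmonic_extension p w -> harmonic_extension q z ->
    wdot (fun v : bdry Omega => (deg Omega (val v))%:R) (linfun (DtN R Omega) p) q
    = energy R n Omega w z.
  by move=> pw [_ zq]; rewrite DtN_fun; apply: wdot_DtN.
have [] := @sum_smallest_eigenvalues_le R _ _ (linfun (DtN R Omega)) n
  (coord_bdry R n Omega) (fun i => #|` edges_par Omega i|%:R) mu0 _ _ E0 _.
- move=> p q; have [w pw] := harmonic_extension_ex n_gt0 p.
  have [z qz] := harmonic_extension_ex n_gt0 q.
  by rewrite [RHS]wdotC (dotE _ _ _ _ pw qz) (dotE _ _ _ _ qz pw) energyC.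
- move=> p; have [w pw] := harmonic_extension_ex n_gt0 p.
  by rewrite (dotE _ _ _ _ pw pw) energy_ge0.
- move=> i j.
  rewrite (dotE _ _ _ _ (coord_harmonic _ _ _ i) (coord_harmonic _ _ _ j)).
  exact: energy_coord.
move=> lambda [lambda_eig n_le sum_le].
have sum_le1 : \sum_(i < n) lambda`_i <=
    \sum_(v : bdry Omega) (deg Omega (val v))%:R^-1 *
      \sum_(i < n) (deg_par Omega i (val v))%:R / #|` edges_par Omega i|%:R.
  apply: le_trans sum_le _; under [leRHS]eq_bigr => v _ do rewrite mulr_sumr.
  rewrite exchange_big; apply: ler_sum => i _ /=.
  under eq_bigr => v _ do rewrite mulrA.
  rewrite -mulr_suml ler_pM2r ?invr_gt0 // DtN_fun; exact: wdot_DtN_coord_le.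
exists lambda; split=> //; apply: le_trans sum_le1 _.
case: arg_minnP => //= m _ m_min.
(* Each boundary vertex contributes at most 1/|E_m|: replacing every |E_i| by the minimum |E_m|
   leaves the sum of the directional degrees, which is deg v. *)
rewrite [#|` bdry Omega|]cardfE -sum1_card natr_sum mulr_suml; apply: ler_sum => v _.
rewrite div1r ler_pdivrMl ?mu0 // -sum_deg_par natr_sum mulr_suml.
apply: ler_sum => i _; rewrite ler_wpM2l //.
by rewrite lef_pV2 ?posrE // ler_nat m_min.
Qed.
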